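(* Let $d\ge1$ be an integer and $s>0$. Let $\{x_n\}_{n\ge1}\subset\mathbb{R}^d$, let $P_n=\{x_1,\dots,x_n\}$ (with $\#P_n=n$), and let $\nu_n=\frac1n\sum_{a\in P_n}\delta_a$. If $\{P_n\}$ is $s$-adaptable and $\nu_n$ weak-$\star$ converges to some Borel probability measure $\mu$ on $\mathbb{R}^d$, then $$\dim_{\mathcal H}(\operatorname{supp}(\mu))\ge s.$$
   Context: For a set $P\subset\mathbb{R}^d$ of $n\ge2$ points and $t>0$, the discrete $t$-energy is $J_t(P)=\frac{1}{n(n-1)}\sum_{x,y\in P,\ x\ne y}|x-y|^{-t}$ (sum over ordered pairs, Euclidean norm). A uniformly bounded sequence of sets $\{P_n\}$ in $\mathbb{R}^d$ with $\#P_n=n$ is called $s$-adaptable if for every $t\in(0,s)$ there is a finite constant $C_t$ with $J_t(P_n)\le C_t$ for all $n\ge2$. Weak-$\star$ convergence $\nu_n\to\mu$ means $\int f\,d\nu_n\to\int f\,d\mu$ for every bounded continuous $f:\mathbb{R}^d\to\mathbb{R}$. $\dim_{\mathcal H}$ denotes Hausdorff dimension; equivalently, with $I_u(\mu)=\iint|x-y|^{-u}\,d\mu(x)\,d\mu(y)$, $\dim_{\mathcal H}(E)=\sup\{\min\{\sup\{u\ge0: I_u(\mu)<\infty\},d\}:\mu$ a Borel probability measure with support in $E\}$. *)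

(* Defs.v *)
From HB Require Import structures.
From mathcomp Require Import all_boot all_order all_algebra finmap.
From mathcomp Require Import all_classical all_reals all_analysis.
Set Implicit Arguments.
Unset Strict Implicit.
Unset Printing Implicit Defensive.
Import Order.TTheory GRing.Theory Num.Theory.
Import numFieldNormedType.Exports.
Local Open Scope classical_set_scope.
Local Open Scope ring_scope.

(* The product topology of 'rV[R]_d is the Euclidean one, but its library norm
   `|x| is the sup norm, so the Euclidean norm is defined here. *)
Definition enorm (R : realType) (d : nat) (x : 'rV[R]_d) : R :=
  Num.sqrt (\sum_(i < d) x 0 i ^+ 2).

(* R^d with its Borel sigma-algebra *)
Notation borel_rV R d := (g_sigma_algebraType (@open 'rV[R]_d)).

Section energy.
Variables (R : realType) (d : nat).
Implicit Types (P : {fset 'rV[R]_d}) (s t : R).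

Definition discrete_energy t P : R :=
  (#|` P|%:R * (#|` P|%:R - 1))^-1 *
  \sum_(x <- P) \sum_(y <- P | x != y) enorm (x - y) `^ (- t).

(* Sequences of sets are indexed from 1: the value at 0 is irrelevant. *)
Definition uniformly_bounded (Ps : nat -> {fset 'rV[R]_d}) : Prop :=
  exists M : R, forall n, (1 <= n)%N -> forall x, x \in Ps n -> enorm x <= M.

Definition adaptable s (Ps : nat -> {fset 'rV[R]_d}) : Prop :=
  [/\ forall n, (1 <= n)%N -> #|` Ps n| = n,
      uniformly_bounded Ps &
      forall t, 0 < t < s ->
        exists C : R, forall n, (2 <= n)%N -> discrete_energy t (Ps n) <= C].

Definition initial_points (x : nat -> 'rV[R]_d) (n : nat) : {fset 'rV[R]_d} :=
  [fset x i | i in iota 1 n]%fset.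

(* (1 / #P) \sum_(a in P) \d_a; the nth below enumerates P without repetition,
   and P = fset0 gives the zero measure. *)
Definition empirical_measure P : {measure set (borel_rV R d) -> \bar R} :=
  mscale (#|` P|%:R^-1)%:nng
    (msum (fun k => \d_(nth 0 (enum_fset P) k : borel_rV R d)) #|` P|).

End energy.

Section measures.
Variables (R : realType) (d : nat).

Definition weak_star_cvg (nu : nat -> {measure set (borel_rV R d) -> \bar R})
    (mu : {measure set (borel_rV R d) -> \bar R}) : Prop :=
  forall f : 'rV[R]_d -> R, continuous f ->
    (exists M : R, forall x, `|f x| <= M) ->
    (\int[nu n]_x (f x)%:E)%E @[n --> \oo] --> (\int[mu]_x (f x)%:E)%E.

Definition measure_support (mu : {measure set (borel_rV R d) -> \bar R}) :
    set 'rV[R]_d :=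
  [set x | forall U : set 'rV[R]_d, open U -> U x -> (0 < mu U)%E].

End measures.

Section hausdorff.
Variables (R : realType) (d : nat).
Implicit Types A E : set 'rV[R]_d.
Local Open Scope ereal_scope.

Definition ediam A : \bar R :=
  ereal_sup [set (enorm (p.1 - p.2))%:E | p in A `*` A].

(* diam(A)^t with the convention diam(set0)^t = 0 for every t, including t = 0;
   for nonempty A, poweR gives 0^0 = 1. *)
Definition ediam_pow (t : R) A : \bar R :=
  if A == set0 then 0 else poweR (ediam A) t.

Definition hausdorff_premeasure (t delta : R) E : \bar R :=
  ereal_inf [set \sum_(0 <= k <oo) ediam_pow t (U k) |
    U in [set U : nat -> set 'rV[R]_d |
           E `<=` \bigcup_k U k /\ forall k, ediam (U k) <= delta%:E]].

(* the supremum over delta > 0 is the limit as delta tends to 0 *)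
Definition hausdorff_measure (t : R) E : \bar R :=
  ereal_sup [set hausdorff_premeasure t delta E |
    delta in [set delta : R | (0 < delta)%R]].

Definition hausdorff_dim E : \bar R :=
  ereal_inf [set t%:E | t in [set t : R | (0 <= t)%R /\ hausdorff_measure t E = 0]].

End hausdorff.

(* Main.v *)
Require Import Defs.
From HB Require Import structures.
From mathcomp Require Import all_boot all_order all_algebra finmap.
From mathcomp Require Import all_classical all_reals all_analysis.
From mathcomp Require Import measurable_realfun.
From mathcomp Require Import ring lra.
Import Order.TTheory GRing.Theory Num.Theory.
Import numFieldNormedType.Exports.
Local Open Scope classical_set_scope.
Local Open Scope ring_scope.

(** The argument is a discrete mass distribution principle, run at the level of
the point sets [P_n] instead of the energy integral of [mu].  Suppose that
[supp mu] had zero [t]-dimensional Hausdorff measure for some [t < s], and pick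
[u] with [t < u < s], so that [0 < u] and the [u]-energies of the [P_n] are
bounded by some [C].  Then [supp mu] is covered by countably many balls of radii
[r_k] with [\sum_k r_k ^ u] as small as desired
([hausdorff_null_ball_cover]).

Let [phi_k >= 0] be continuous functions subordinate to the doubled balls, with
[\sum_k phi_k <= 1] everywhere and [= 1] on the cover ([peel], [bump_fun]).
Since two points of the support of [phi_k] are at distance at most a constant
times [r_k], inserting [\sum_k phi_k x * phi_k y <= 1] in the double sum that
defines the energy separates the variables ([pair_energy_ge]): up to the diagonal,
[\sum_k (\int phi_k d nu_n) ^ 2 / r_k ^ u] is bounded by a constant times
the [u]-energy of [P_n].  The diagonal has relative weight [1 / n], hence in the limit
[\sum_k m_k ^ 2 / r_k ^ u <= C'] with [m_k = \int phi_k d mu]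
([sum_sqr_integral_le]).  Separating the variables before the limit is what makes
the weak convergence of [nu_n], tested on single functions, sufficient: neither
the product measures nor a truncation of the kernel is involved.

The measure [mu] is carried by its support ([measure_support_full]), where the
[phi_k] sum to [1], so [\sum_k m_k = 1] ([nneseries_integral_eq1]).  But the
inequality of arithmetic and geometric means gives
[m_k <= m_k ^ 2 / (4 C' r_k ^ u) + C' r_k ^ u], whose sum is at most [1 / 2] once
[\sum_k r_k ^ u] is small enough: a contradiction. *)

Set Implicit Arguments.
Unset Strict Implicit.

(** * Euclidean norm and sup norm *)

Lemma normr_le_enorm (R : realType) (d : nat) (v : 'rV[R]_d) : `|v| <= enorm v.
Proof.
rewrite -[X in X <= _]/(mx_norm v) mx_normrE; apply/bigmax_leP; split=> [|[i j] _ /=].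
  exact: sqrtr_ge0.
rewrite ord1 -sqrtr_sqr ler_wsqrtr// (bigD1 j)//= lerDl.
by apply: sumr_ge0 => k _; exact: sqr_ge0.
Qed.

Lemma enorm_le_normr (R : realType) (d : nat) (v : 'rV[R]_d) :
  enorm v <= Num.sqrt d%:R * `|v|.
Proof.
have -> : Num.sqrt d%:R * `|v| = Num.sqrt (d%:R * `|v| ^+ 2).
  by rewrite sqrtrM ?ler0n// sqrtr_sqr normr_id.
apply: ler_wsqrtr; rewrite mulr_natl.
have -> : `|v| ^+ 2 *+ d = \sum_(i < d) `|v| ^+ 2 by rewrite sumr_const card_ord.
apply: ler_sum => i _; rewrite -real_normK ?num_real// ler_sqr ?nnegrE//.
by rewrite -[X in _ <= X]/(mx_norm v) mx_normrE; exact: (le_bigmax _ _ (0, i)).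
Qed.

Lemma enorm_gt0 (R : realType) (d : nat) (v : 'rV[R]_d) : v != 0 -> 0 < enorm v.
Proof. by move=> v0; rewrite (lt_le_trans _ (normr_le_enorm _)) ?normr_gt0. Qed.

(** * Borel measures on the space of row vectors *)

Lemma open_measurable_rV (R : realType) (d : nat) (U : set 'rV[R]_d) :
  open U -> measurable (U : set (borel_rV R d)).
Proof. by move=> oU; exact: sub_sigma_algebra. Qed.

Lemma continuous_measurable_rV (R : realType) (d : nat) (f : 'rV[R]_d -> R) :
  continuous f -> measurable_fun setT (f : borel_rV R d -> R).
Proof.
move=> /continuousP cf; apply: (measurability _ (RGenOpens.measurableE R)).
move=> _ [_ [a [b ->] <-]]; rewrite setTI; apply: open_measurable_rV.
exact/cf/interval_open.
Qed.

(** The complement of the support is a union of open null sets; it is a countable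
one because the balls with rational centers and radii [1 / n] form a base of the
topology, so that it suffices to unite those of them that are null. *)
Lemma measure_support_full (R : realType) (d : nat)
    (mu : {measure set (borel_rV R d) -> \bar R}) :
  mu.-negligible (~` measure_support mu).
Proof.
(* [F] enumerates the null balls of the base, padded with empty sets. *)
pose F (k : nat) : set (borel_rV R d) :=
  if @pickle_inv ('rV[rat]_d * nat)%type k is Some (q, n) then
    let B := ball (map_mx (ratr : rat -> R) q) n.+1%:R^-1 in
    if `[< mu B = 0%E >] then B else set0
  else set0.
suff : ~` measure_support mu `<=` \bigcup_k F k.
  move=> h; apply: (negligibleS (mu:=mu) h); apply: negligible_bigcup => k; rewrite /F.
  case: pickle_inv => [[q n]|]; last exact: negligible_set0.
  case: asboolP => [B0|_]; last exact: negligible_set0.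
  apply/negligibleP => //; apply: open_measurable_rV; exact: ball_open.
move=> x /= /existsNP[U] /not_implyP[oU] /not_implyP[Ux] muU.
have {}muU : mu U = 0%E.
  by apply/eqP; rewrite eq_le measure_ge0 andbT leNgt; exact/negP.
have /nbhs_ballP[e /= e0 xeU] : nbhs x U by exact: open_nbhs_nbhs.
have [n ne] : exists n : nat, (n.+1%:R^-1 : R) < e / 2.
  by have [n nlt] := ltr_add_invr (divr_gt0 e0 (ltr0Sn R 1)); exists n; rewrite -[X in X < _]add0r.
have n0 : 0 < (n.+1%:R^-1 : R) by rewrite invr_gt0.
have hq i : exists q : rat, `|x 0 i - ratr q| < n.+1%:R^-1.
  have [|q] := @rat_in_itvoo R (x 0 i - n.+1%:R^-1) (x 0 i + n.+1%:R^-1).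
    by rewrite ltrBlDr -addrA ltrDl addr_gt0.
  by rewrite in_itv/= => qx; exists q; rewrite distrC ltr_distl.
pose q : 'rV[rat]_d := \row_i projT1 (cid (hq i)).
pose B : set 'rV[R]_d := ball (map_mx (ratr : rat -> R) q) n.+1%:R^-1.
have Bx : B x.
  split => // i j; rewrite ord1 /ball/= !mxE distrC.
  by case: cid.
have BU : B `<=` U.
  move=> y By; apply: xeU; rewrite (splitr e).
  apply: (@ball_triangle _ _ (map_mx (ratr : rat -> R) q)).
    by apply: ball_sym; apply: le_ball Bx; exact: ltW.
  by apply: le_ball By; exact: ltW.
exists (choice.pickle (q, n)) => //; rewrite /F.
rewrite pickleK_inv asboolT//.
apply/eqP; rewrite eq_le measure_ge0 andbT -[X in (_ <= X)%E]muU.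
by apply: le_measure => //; rewrite inE; apply: open_measurable_rV => //; exact: ball_open.
Qed.

Lemma integral_empirical_measure (R : realType) (d : nat) (P : {fset 'rV[R]_d})
    (f : 'rV[R]_d -> R) : continuous f -> (forall x, 0 <= f x) ->
  (\int[empirical_measure P]_x (f x)%:E)%E = (#|` P|%:R^-1 * \sum_(x <- P) f x)%:E.
Proof.
move=> cf f0.
have mf : measurable_fun setT (EFin \o f : borel_rV R d -> \bar R).
  by apply/measurable_EFinP; exact: continuous_measurable_rV.
rewrite ge0_integral_mscale//=; last by move=> x _; rewrite lee_fin.
rewrite ge0_integral_measure_sum//; last by move=> x _; rewrite lee_fin.
rewrite (eq_bigr (fun k : 'I__ => (f (nth 0 (enum_fset P) k))%:E)); last first.
  by move=> k _; rewrite /= integral_dirac// diracT mul1e.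
by rewrite sumEFin -EFinM; congr (_ * _)%:E; rewrite (big_nth 0) big_mkord.
Qed.

(** * Subordinate functions *)

(** Functional analogue of making a sequence of sets disjoint: if [f k] is the
indicator of [A k], then [peel f k] is the indicator of [A k] minus the earlier
sets.  Unlike that set difference, it preserves continuity. *)
Definition peel (R : realType) (T : Type) (f : nat -> T -> R) (k : nat) (x : T) : R :=
  f k x * \prod_(j < k) (1 - f j x).

Lemma sum_peel (R : realType) (T : Type) (f : nat -> T -> R) (N : nat) (x : T) :
  \sum_(k < N) peel f k x = 1 - \prod_(k < N) (1 - f k x).
Proof.
elim: N => [|N IH]; first by rewrite !big_ord0 subrr.
by rewrite !big_ord_recr/= IH /peel; ring.
Qed.

Section peel.
Variables (R : realType) (T : Type) (f : nat -> T -> R).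
Hypothesis f01 : forall k x, 0 <= f k x <= 1.

Let prod01 k x : 0 <= \prod_(j < k) (1 - f j x) <= 1.
Proof.
apply/andP; split; first by apply: prodr_ge0 => j _; rewrite subr_ge0; case/andP: (f01 j x).
apply: prodr_ile1 => j _.
by have /andP[f0 f1] := f01 j x; rewrite subr_ge0 f1 lerBlDr lerDl.
Qed.

Lemma peel_ge0 k x : 0 <= peel f k x.
Proof. by rewrite /peel mulr_ge0//; [case/andP: (f01 k x)|case/andP: (prod01 k x)]. Qed.

Lemma sum_peel_le1 N x : \sum_(k < N) peel f k x <= 1.
Proof. by rewrite sum_peel lerBlDr lerDl; case/andP: (prod01 N x). Qed.

Lemma peel_le1 k x : peel f k x <= 1.
Proof.
apply: le_trans (sum_peel_le1 k.+1 x); rewrite big_ord_recr/= lerDr.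
by apply: sumr_ge0 => j _; exact: peel_ge0.
Qed.

End peel.

Lemma sum_peel_eq1 (R : realType) (T : Type) (f : nat -> T -> R) k N x :
  f k x = 1 -> (k < N)%N -> \sum_(j < N) peel f j x = 1.
Proof.
by move=> fk kN; rewrite sum_peel (bigD1 (Ordinal kN))//= fk subrr mul0r subr0.
Qed.

Lemma peel_neq0 (R : realType) (T : Type) (f : nat -> T -> R) k x :
  peel f k x != 0 -> f k x != 0.
Proof. by apply: contraNneq; rewrite /peel => ->; rewrite mul0r. Qed.

Lemma continuous_peel (R : realType) (T : topologicalType) (f : nat -> T -> R) k :
  (forall j, continuous (f j)) -> continuous (peel f k).
Proof.
move=> cf x; apply: cvgM; first exact: cf.
elim: k => [|k IH].
  by under eq_cvg do rewrite big_ord0; rewrite big_ord0; exact: cvg_cst.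
under eq_cvg do rewrite big_ord_recr/=; rewrite big_ord_recr/=.
by apply: cvgM => //; apply: cvgB; [exact: cvg_cst|exact: cf].
Qed.

(** Plateau of height [1] on the ball of radius [r], vanishing outside the ball of
radius [2 * r].  The norm is that of [V]: for row vectors it is the sup norm, which
costs only a constant factor against the Euclidean one. *)
Definition bump_fun (R : realType) (V : normedModType R) (a : V) (r : R) (x : V) : R :=
  Num.max 0 (Num.min 1 (2 - `|x - a| / r)).

Section bump.
Variables (R : realType) (V : normedModType R) (a : V) (r : R).

Lemma bump_bound x : 0 <= bump_fun a r x <= 1.
Proof. by rewrite /bump_fun le_max lexx/= ge_max ler01 ge_min lexx. Qed.

Hypothesis r0 : 0 < r.

Lemma bump_eq1 x : `|x - a| <= r -> bump_fun a r x = 1.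
Proof.
move=> xr; have xr1 : `|x - a| / r <= 1 by rewrite ler_pdivrMr// mul1r.
rewrite /bump_fun min_l; last by rewrite lerBrDl; lra.
by rewrite max_r.
Qed.

Lemma bump_neq0 x : bump_fun a r x != 0 -> `|x - a| < 2 * r.
Proof.
apply: contraNT; rewrite -leNgt -ler_pdivlMr// => xr.
by rewrite /bump_fun max_l// ge_min subr_le0 xr orbT.
Qed.

Lemma continuous_bump : continuous (bump_fun a r).
Proof.
apply: max_fun_continuous; first exact: cst_continuous.
apply: min_fun_continuous; first exact: cst_continuous.
move=> x; apply: cvgB; first exact: cvg_cst.
apply: cvgMl; apply: cvg_norm; apply: cvgB; [exact: cvg_id|exact: cvg_cst].
Qed.

End bump.

(** * Lower bound of a discrete energy *)

(** The square of the sum is the sum over all pairs, and each of the [#|` P|]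
diagonal terms is at most [1]. *)
Lemma sum_sqr_le_pair_sum (R : realType) (d : nat) (P : {fset 'rV[R]_d})
    (f : 'rV[R]_d -> R) : (forall x, 0 <= f x <= 1) ->
  (\sum_(x <- P) f x) ^+ 2 - #|` P|%:R <= \sum_(x <- P) \sum_(y <- P | x != y) f x * f y.
Proof.
move=> f01; rewrite lerBlDr expr2 big_distrlr/=.
have -> : (#|` P|%:R : R) = \sum_(x <- P) 1 by rewrite big_const_seq iter_addr_0 count_predT.
rewrite -big_split/= ![X in X <= _]big_seq ![X in _ <= X]big_seq; apply: ler_sum => x xP.
rewrite (bigD1_seq x)//=; last exact: fset_uniq.
rewrite addrC; under eq_bigl do rewrite eq_sym.
rewrite lerD2l; have /andP[f0 f1] := f01 x.
by apply: mulr_ile1.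
Qed.

(** For [x != y], every [k] with [phi k x * phi k y != 0] satisfies
[enorm (x - y) <= D k], so that
[\sum_k phi k x * phi k y / D k ^ u <= enorm (x - y) ^ (- u) * \sum_k phi k x * phi k y],
and the last sum is at most [\sum_k phi k x <= 1].  It remains to sum over the pairs
and to exchange the sums. *)
Lemma pair_energy_ge (R : realType) (d : nat) (P : {fset 'rV[R]_d}) (u : R)
    (N : nat) (phi : nat -> 'rV[R]_d -> R) (D : nat -> R) :
    0 < u -> (forall k x, 0 <= phi k x) -> (forall x, \sum_(k < N) phi k x <= 1) ->
    (forall k, 0 < D k) ->
    (forall k x y, phi k x != 0 -> phi k y != 0 -> enorm (x - y) <= D k) ->
  \sum_(k < N) ((\sum_(x <- P) phi k x) ^+ 2 - #|` P|%:R) / D k `^ u <=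
  \sum_(x <- P) \sum_(y <- P | x != y) enorm (x - y) `^ (- u).
Proof.
move=> u0 phi0 phi1 D0 phiD.
have phile1 (k : 'I_N) x : phi k x <= 1.
  by apply: le_trans (phi1 x); rewrite (bigD1 k)//= lerDl sumr_ge0.
pose S (k : nat) := \sum_(x <- P) \sum_(y <- P | x != y) phi k x * phi k y.
apply: (@le_trans _ _ (\sum_(k < N) S k / D k `^ u)).
  apply: ler_sum => k _; rewrite ler_wpM2r ?invr_ge0 ?powR_ge0//.
  by apply: sum_sqr_le_pair_sum => x; rewrite phi0 phile1.
under eq_bigr do rewrite mulr_suml.
rewrite exchange_big/=; apply: ler_sum => x _.
under eq_bigr do rewrite mulr_suml.
rewrite exchange_big/=; apply: ler_sum => y xy.
have e0 : 0 < enorm (x - y) by rewrite enorm_gt0// subr_eq0.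
apply: (@le_trans _ _ (\sum_(k < N) phi k x * enorm (x - y) `^ (- u))); last first.
  by rewrite -mulr_suml ler_piMl ?powR_ge0.
apply: ler_sum => k _.
have [->|px] := eqVneq (phi k x) 0; first by rewrite !mul0r.
have [->|py] := eqVneq (phi k y) 0; first by rewrite mulr0 !mul0r mulr_ge0 ?powR_ge0.
rewrite -mulrA ler_wpM2l//.
apply: (@le_trans _ _ ((D k `^ u)^-1)).
  by rewrite ler_piMl ?invr_ge0 ?powR_ge0.
rewrite powRN lef_pV2 ?posrE ?powR_gt0//.
by apply: (ge0_ler_powR (ltW u0)); [exact: ltW|exact: ltW|exact: phiD].
Qed.

(** * Coverings of a set of zero Hausdorff measure *)

Lemma hausdorff_null_cover (R : realType) (d : nat) (t eps : R) (E : set 'rV[R]_d) :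
    hausdorff_measure t E = 0%E -> 0 < eps ->
  exists U : nat -> set 'rV[R]_d, [/\ E `<=` \bigcup_k U k,
    forall k, (ediam (U k) <= 1%:E)%E &
    (\sum_(0 <= k <oo) ediam_pow t (U k) < eps%:E)%E].
Proof.
move=> E0 eps0.
have : (hausdorff_premeasure t 1 E < eps%:E)%E.
  apply: (@le_lt_trans _ _ 0%E); last by rewrite lte_fin.
  by rewrite -E0; apply: ereal_sup_ubound; exists 1 => //=.
by move=> /ereal_inf_lt[_ [U [EU U1] <-] ltU]; exists U.
Qed.

Lemma enorm_sub_le_ediam (R : realType) (d : nat) (A : set 'rV[R]_d) x y :
  A x -> A y -> ((enorm (x - y))%:E <= ediam A)%E.
Proof. by move=> Ax Ay; apply: ereal_sup_ubound; exists (x, y). Qed.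

Lemma ediam_ge0 (R : realType) (d : nat) (A : set 'rV[R]_d) :
  A !=set0 -> (0 <= ediam A)%E.
Proof.
move=> [x Ax]; apply: le_trans (enorm_sub_le_ediam Ax Ax).
by rewrite lee_fin sqrtr_ge0.
Qed.

Lemma ediam_pow_ge0 (R : realType) (d : nat) (t : R) (A : set 'rV[R]_d) :
  (0 <= ediam_pow t A)%E.
Proof. by rewrite /ediam_pow; case: ifP => // _; exact: poweR_ge0. Qed.

Lemma ediam_pow_fin_num (R : realType) (d : nat) (t : R) (A : set 'rV[R]_d) :
  (ediam A <= 1%:E)%E -> ediam_pow t A \is a fin_num.
Proof.
rewrite /ediam_pow; case: eqVneq => // /set0P A0; have := ediam_ge0 A0.
by case: (ediam A).
Qed.

(** Powers of a positive number at most [1] decrease with the exponent.  This says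
nothing when [x = y]: then the left-hand side is [0] because [0 < u], even if
[t = 0], where [ediam_pow] is [1]. *)
Lemma enorm_powR_le_ediam_pow (R : realType) (d : nat) (t u : R) (A : set 'rV[R]_d) x y :
    0 <= t <= u -> 0 < u -> (ediam A <= 1%:E)%E -> A x -> A y ->
  ((enorm (x - y) `^ u)%:E <= ediam_pow t A)%E.
Proof.
move=> /andP[t0 tu] u0 A1 Ax Ay.
have := enorm_sub_le_ediam Ax Ay.
rewrite /ediam_pow; case: eqVneq => [A0|_]; first by rewrite A0 in Ax.
have := ediam_ge0 (ex_intro _ x Ax); move: A1.
case: (ediam A) => //= r; rewrite !lee_fin => r1 r0 er.
have := sqrtr_ge0 (\sum_(i < d) (x - y) 0 i ^+ 2).
rewrite -/(enorm (x - y)) le_eqVlt => /predU1P[<-|e0].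
  by rewrite powR0 ?gt_eqF// powR_ge0.
apply: (@le_trans _ _ (enorm (x - y) `^ t)).
  by apply: ger_powR => //; rewrite e0 (le_trans er).
by apply: ge0_ler_powR => //; rewrite nnegrE// ltW.
Qed.

(** The sets of an efficient cover are replaced by balls centered at one of their
points.  The radii must be positive even for singletons and for empty sets, whence the
summable excess [e k] added to the [u]-th power of the radius. *)
Lemma hausdorff_null_ball_cover (R : realType) (d : nat) (t u eps : R)
    (E : set 'rV[R]_d) :
    0 <= t <= u -> 0 < u -> hausdorff_measure t E = 0%E -> 0 < eps ->
  exists (a : nat -> 'rV[R]_d) (r : nat -> R), [/\ forall k, 0 < r k,
    forall x, E x -> exists k, `|x - a k| <= r k &
    forall N, \sum_(k < N) r k `^ u <= eps].
Proof.
move=> tu u0 E0 eps0; have eps20 : 0 < eps / 2 by rewrite divr_gt0.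
have [U [EU U1 ltU]] := hausdorff_null_cover E0 eps20.
pose e (k : nat) : R := eps / 2 / (2 ^ k.+1)%:R.
have e0 k : 0 < e k by rewrite divr_gt0// ltr0n expn_gt0.
pose w k := fine (ediam_pow t (U k)) + e k.
have w0 k : 0 < w k by rewrite ltr_wpDl// fine_ge0// ediam_pow_ge0.
exists (fun k => xget 0 (U k)), (fun k => w k `^ u^-1); split.
- by move=> k; rewrite powR_gt0.
- move=> x /EU[k _ Ukx]; exists k.
  have Uka : U k (xget 0 (U k)) by exact: xgetPex (ex_intro _ x Ukx).
  apply: le_trans (normr_le_enorm _) _.
  have uV : u / u = 1 by rewrite mulfV// gt_eqF.
  rewrite -[leLHS]powRr1 ?sqrtr_ge0// -uV powRrM.
  apply: ge0_ler_powR; rewrite ?nnegrE ?invr_ge0 ?powR_ge0 ?(ltW u0) ?(ltW (w0 k))//.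
  have := enorm_powR_le_ediam_pow tu u0 (U1 k) Ukx Uka.
  rewrite -[X in (_ <= X)%E -> _]fineK ?ediam_pow_fin_num// lee_fin => /le_trans; apply.
  by rewrite lerDl ltW.
- move=> N; under eq_bigr do rewrite -powRrM mulVf ?gt_eqF// powRr1 ?(ltW (w0 _))//.
  rewrite -lee_fin -sumEFin.
  apply: (@le_trans _ _ (\sum_(0 <= k <oo) (ediam_pow t (U k) + (e k)%:E))%E).
    have wE k : (w k)%:E = (ediam_pow t (U k) + (e k)%:E)%E.
      by rewrite EFinD fineK// ediam_pow_fin_num.
    under eq_bigr do rewrite wE.
    rewrite -(big_mkord xpredT (fun k => (ediam_pow t (U k) + (e k)%:E)%E)).
    by apply: nneseries_lim_ge => k _ _; rewrite -wE lee_fin ltW.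
  apply: le_trans (epsilon_trick _ _ (ltW eps20)) _.
    by move=> k; exact: ediam_pow_ge0.
  by rewrite [in leRHS](splitr eps) EFinD leeD2r// ltW.
Qed.

(** * Passing to the limit *)

Lemma integral_unit_fin_num d0 (T : measurableType d0) (R : realType)
    (mu : probability T R) (f : T -> R) :
    measurable_fun setT f -> (forall x, 0 <= f x <= 1) ->
  (\int[mu]_x (f x)%:E)%E \is a fin_num.
Proof.
move=> mf f01; have mEf : measurable_fun setT (EFin \o f) by exact/measurable_EFinP.
have f0 x : (0 <= (f x)%:E)%E by rewrite lee_fin; case/andP: (f01 x).
rewrite ge0_fin_numE; last by apply: integral_ge0 => x _; exact: f0.
apply: (@le_lt_trans _ _ (\int[mu]_x (cst 1%E x))%E).
  by apply: ge0_le_integral => // x _; rewrite lee_fin; case/andP: (f01 x).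
by rewrite integral_cst// mul1e (le_lt_trans (probability_le1 _ _)) ?ltry.
Qed.

Lemma nneseries_integral_eq1 d0 (T : measurableType d0) (R : realType)
    (mu : probability T R) (E : set T) (phi : nat -> T -> R) :
    (forall k, measurable_fun setT (phi k)) -> (forall k x, 0 <= phi k x) ->
    mu.-negligible (~` E) ->
    (forall x, E x -> exists k, forall N, (k < N)%N -> \sum_(j < N) phi j x = 1) ->
  (\sum_(0 <= k <oo) \int[mu]_x (phi k x)%:E = 1)%E.
Proof.
move=> mphi phi0 E0 phi1.
have mE k : measurable_fun setT (EFin \o phi k) by exact/measurable_EFinP.
rewrite -integral_nneseries//; last by move=> k x _; rewrite lee_fin.
transitivity (\int[mu]_x (cst 1%E x))%E; last first.
  by rewrite integral_cst// mul1e; exact: probability_setT.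
apply: ae_eq_integral => //.
  apply: (@ge0_emeasurable_sum _ _ _ setT (fun k => EFin \o phi k) xpredT).
    by move=> k x _ _; rewrite lee_fin.
  by move=> k _; exact: mE.
apply: negligibleS E0 => x /= /not_implyP[_ nx] Ex; apply: nx.
have [k phik] := phi1 x Ex.
apply: cvg_lim => //; apply: cvg_near_cst; exists k.+1 => // N /= kN.
by rewrite big_mkord sumEFin phik.
Qed.

(** Only finitely many integrals occur, so testing the weak convergence on each
[phi k] suffices.  After division of [pair_energy_ge] by [n ^ 2], the diagonal
contributes [1 / n], which vanishes in the limit. *)
Lemma sum_sqr_integral_le (R : realType) (d : nat) (Ps : nat -> {fset 'rV[R]_d})
    (mu : probability (borel_rV R d) R) (u C : R)
    (N : nat) (phi : nat -> 'rV[R]_d -> R) (D : nat -> R) :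
    (forall n, (1 <= n)%N -> #|` Ps n| = n) ->
    weak_star_cvg (fun n => empirical_measure (Ps n)) mu ->
    0 < u -> (forall n, (2 <= n)%N -> discrete_energy u (Ps n) <= C) ->
    (forall k, continuous (phi k)) -> (forall k x, 0 <= phi k x <= 1) ->
    (forall x, \sum_(k < N) phi k x <= 1) -> (forall k, 0 < D k) ->
    (forall k x y, phi k x != 0 -> phi k y != 0 -> enorm (x - y) <= D k) ->
  \sum_(k < N) fine (\int[mu]_x (phi k x)%:E)%E ^+ 2 / D k `^ u <= C.
Proof.
move=> cardP cvgP u0 PC cphi phi01 phi1 D0 phiD.
have phi0 k x : 0 <= phi k x by case/andP: (phi01 k x).
pose m k n : R := #|` Ps n|%:R^-1 * \sum_(x <- Ps n) phi k x.
have cvgm k : m k n @[n --> \oo] --> fine (\int[mu]_x (phi k x)%:E)%E.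
  have bphi : exists M, forall x, `|phi k x| <= M.
    by exists 1 => x; rewrite ger0_norm//; case/andP: (phi01 k x).
  have finI : (\int[mu]_x (phi k x)%:E)%E \is a fin_num.
    by apply: integral_unit_fin_num => //; exact: continuous_measurable_rV.
  have := cvgP _ (cphi k) bphi.
  under eq_cvg do rewrite integral_empirical_measure//.
  by rewrite -(fineK finI) => /fine_cvg.
(* The index is shifted by two, so that the cardinal and the energy bound apply. *)
pose v n := \sum_(k < N) (m k n.+2 ^+ 2 - n.+2%:R^-1) / D k `^ u.
have cvgv : v n @[n --> \oo] -->
    \sum_(k < N) fine (\int[mu]_x (phi k x)%:E)%E ^+ 2 / D k `^ u.
  apply: cvg_big => [|k _]; first exact: add_continuous.
  apply: cvgMl.
  rewrite -[X in _ --> X]subr0; apply: cvgB.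
    rewrite expr2; under eq_cvg do rewrite expr2.
    have cm : m k n.+2 @[n --> \oo] --> fine (\int[mu]_x (phi k x)%:E)%E.
      by have := cvgm k; rewrite -(cvg_shiftn 2); under eq_cvg do rewrite /= addn2.
    exact: cvgM.
  have := @cvg_harmonic R; rewrite -cvg_shiftS; exact.
rewrite -(cvg_lim _ cvgv)//; apply: limr_le; first by apply/cvg_ex; eexists; exact: cvgv.
near=> n; apply: le_trans (PC n.+2 _) => //.
rewrite /discrete_energy; set S := \sum_(x <- Ps n.+2) _.
have cardn : #|` Ps n.+2| = n.+2 by exact: cardP.
have := @pair_energy_ge R d (Ps n.+2) u N phi D u0 phi0 phi1 D0 phiD.
rewrite -/S cardn => leS.
have n0 : 0 < n.+2%:R :> R by rewrite ltr0n.
have S0 : 0 <= S.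
  by apply: sumr_ge0 => x _; apply: sumr_ge0 => y _; exact: powR_ge0.
apply: (@le_trans _ _ ((n.+2%:R * n.+2%:R)^-1 * S)).
  apply: le_trans (ler_wpM2l _ leS); last by rewrite invr_ge0 mulr_ge0// ltW.
  rewrite mulr_sumr; apply: ler_sum => k _; rewrite mulrA ler_wpM2r ?invr_ge0 ?powR_ge0//.
  by rewrite /m cardn le_eqVlt; apply/orP; left; apply/eqP; field; rewrite gt_eqF.
have n1 : 0 < n.+2%:R - 1 :> R by rewrite subr_gt0 ltr1n.
apply: ler_wpM2r => //; rewrite lef_pV2 ?posrE ?(mulr_gt0 n0)//.
by rewrite ler_pM2l// gerBl.
Unshelve. all: by end_near. Qed.

(** * The dimension bound *)

Unset Implicit Arguments.

Theorem corollary2p7 (R : realType) (d : nat) (hd : (1 <= d)%N)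
    (s : R) (hs : 0 < s)
    (x : nat -> 'rV[R]_d)
    (hcard : forall n, (1 <= n)%N -> #|` initial_points x n| = n)
    (hadapt : adaptable s (initial_points x))
    (mu : probability (borel_rV R d) R)
    (hcvg : weak_star_cvg (fun n => empirical_measure (initial_points x n)) mu) :
  (s%:E <= hausdorff_dim (measure_support mu))%E.
Proof.
apply: le_ereal_inf_tmp => _ [t [t0 Ht] <-]; rewrite lee_fin leNgt; apply/negP => ts.
pose u := (t + s) / 2.
have tu : 0 <= t <= u by rewrite t0/= /u ler_pdivlMr//; lra.
have us : 0 < u < s by rewrite /u divr_gt0 ?ltr_wpDl//= ltr_pdivrMr//; lra.
have u0 : 0 < u by case/andP: us.
have [_ _ /(_ u us)[C0 hC0]] := hadapt.
(* The bound is made positive because [amgm] below divides by it. *)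
pose C := `|C0| + 1.
have C_gt0 : 0 < C by rewrite ltr_wpDl.
have hC n : (2 <= n)%N -> discrete_energy u (initial_points x n) <= C.
  by move=> /hC0/le_trans; apply; rewrite /C (le_trans (ler_norm _))// lerDl.
(* The Euclidean diameter of the support of [phi k] is at most [l * r k]: the
   support lies in the sup-norm ball of radius [2 * r k]. *)
pose l := Num.sqrt d%:R * 4 : R.
have l0 : 0 < l by rewrite mulr_gt0// sqrtr_gt0 ltr0n.
pose c := l `^ u.
have c0 : 0 < c by rewrite powR_gt0.
(* With this bound, the second terms of [amgm] below sum to at most [1 / 4]. *)
have eps0 : 0 < (4 * C * c)^-1 by rewrite invr_gt0 !mulr_gt0.
have [a [r [r0 cover sumr]]] := hausdorff_null_ball_cover tu u0 Ht eps0.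
pose f k := bump_fun (a k) (r k).
have f01 k y : 0 <= f k y <= 1 by exact: bump_bound.
pose phi := peel f.
have phi0 k y : 0 <= phi k y by exact: peel_ge0.
have cphi k : continuous (phi k).
  by apply: continuous_peel => j; exact: continuous_bump.
have phi01 k y : 0 <= phi k y <= 1 by rewrite phi0/=; exact: peel_le1.
pose m k := fine (\int[mu]_y (phi k y)%:E)%E.
have D0 k : 0 < l * r k by rewrite mulr_gt0.
have phi_ball k y : phi k y != 0 -> `|y - a k| < 2 * r k.
  by move=> phiky; apply: bump_neq0 => //; exact: peel_neq0 phiky.
have phiD k y z : phi k y != 0 -> phi k z != 0 -> enorm (y - z) <= l * r k.
  move=> /phi_ball ya /phi_ball za.
  apply: le_trans (enorm_le_normr _) _; rewrite /l -mulrA ler_wpM2l ?sqrtr_ge0//.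
  apply: le_trans (ler_distD (a k) _ _) _; rewrite (distrC (a k)).
  by have := r0 k; lra.
have energy N : \sum_(k < N) m k ^+ 2 / (l * r k) `^ u <= C.
  exact: (sum_sqr_integral_le hcard hcvg u0 hC cphi phi01 (sum_peel_le1 f01 N) D0 phiD).
have mphi k : measurable_fun setT (phi k : borel_rV R d -> R).
  exact: continuous_measurable_rV.
have total_mass : (\sum_(0 <= k <oo) \int[mu]_y (phi k y)%:E = 1)%E.
  apply: (@nneseries_integral_eq1 _ _ _ mu (measure_support mu) phi) => //.
    exact: measure_support_full.
  move=> y /cover[k yk]; exists k => N kN; apply: (sum_peel_eq1 _ kN).
  exact: bump_eq1.
suff : (1%:E <= (2^-1)%:E :> \bar R)%E by rewrite lee_fin; lra.
rewrite -[leLHS]total_mass; apply: lime_le.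
  by apply: is_cvg_nneseries => k _ _; apply: integral_ge0 => y _; rewrite lee_fin.
apply: nearW => N; rewrite big_mkord.
have amgm k : m k <= (4 * C)^-1 * (m k ^+ 2 / (l * r k) `^ u) + C * c * r k `^ u.
  rewrite powRM ?(ltW l0) ?(ltW (r0 k))// -/c -mulrA.
  set w := c * r k `^ u.
  have w0 : 0 < w by rewrite mulr_gt0 ?powR_gt0.
  rewrite -subr_ge0.
  have -> : (4 * C)^-1 * (m k ^+ 2 / w) + C * w - m k =
      (4 * C * w)^-1 * (m k - 2 * C * w) ^+ 2.
    by field; rewrite !gt_eqF.
  apply: mulr_ge0; last exact: sqr_ge0.
  by rewrite invr_ge0 ltW// (mulr_gt0 _ w0)// mulr_gt0.
have -> : (\sum_(k < N) \int[mu]_y (phi k y)%:E)%E = (\sum_(k < N) m k)%:E.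
  rewrite -sumEFin; apply: eq_bigr => k _; rewrite fineK//.
  exact: integral_unit_fin_num.
rewrite lee_fin.
apply: (@le_trans _ _ (\sum_(k < N) ((4 * C)^-1 * (m k ^+ 2 / (l * r k) `^ u) +
    C * c * r k `^ u))); first by apply: ler_sum => k _; exact: amgm.
rewrite big_split/= -!mulr_sumr.
apply: (@le_trans _ _ ((4 * C)^-1 * C + C * c * (4 * C * c)^-1)).
  apply: lerD; apply: ler_wpM2l; [|exact: energy| |exact: sumr].
    by rewrite invr_ge0 ltW// mulr_gt0.
  by rewrite ltW// mulr_gt0.
by rewrite le_eqVlt; apply/orP; left; apply/eqP; field; rewrite !gt_eqF.
Qed.
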